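(* Let $G$ be a finite group and $H$ a subgroup of $G$. Let $Q$ be a Sylow $2$-subgroup of $H$ and $P$ a Sylow $2$-subgroup of the normalizer $N_G(Q)$. Then $H$ is a perfect code of $G$ if and only if $Q$ is a perfect code of $P$.
   Context: All graphs are finite, undirected and simple. A subset $C$ of the vertex set of a graph $\Gamma$ is a perfect code in $\Gamma$ if no two vertices of $C$ are adjacent and every vertex not in $C$ is adjacent to exactly one vertex of $C$. For a finite group $G$ and a subset $S\subseteq G$ with $S^{-1}=S$ and $1\notin S$, the Cayley graph $\mathrm{Cay}(G,S)$ has vertex set $G$, with $x,y$ adjacent iff $yx^{-1}\in S$. A subset $C$ of a group $K$ is called a perfect code of $K$ if there exists such an $S\subseteq K$ for which $C$ is a perfect code in $\mathrm{Cay}(K,S)$. *)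

(* Defs.v *)
From mathcomp Require Import all_boot all_order all_fingroup all_solvable.

Set Implicit Arguments.
Unset Strict Implicit.
Unset Printing Implicit Defensive.

Local Open Scope group_scope.

(* A graph is given by its vertex set V, inside an ambient finite type, and its
   adjacency relation e; only the restriction of e to V matters. *)
Definition perfect_code_in (T : finType) (V : {set T}) (e : rel T)
    (C : {set T}) : Prop :=
  [/\ C \subset V,
      {in C &, forall x y, ~~ e x y} &
      {in V :\: C, forall x, #|[set y in C | e x y]| = 1%N}].

Definition cayley_adj (gT : finGroupType) (S : {set gT}) : rel gT :=
  fun x y => y * x^-1 \in S.

(* S^-1 is the set of inverses of the elements of S. *)
Definition connection_set (gT : finGroupType) (K S : {set gT}) : Prop :=
  [/\ S \subset K, S^-1 = S & 1 \notin S].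

Definition perfect_code_of (gT : finGroupType) (K : {group gT})
    (C : {set gT}) : Prop :=
  exists2 S : {set gT},
    connection_set K S & perfect_code_in K (cayley_adj S) C.

Lemma cayley_adj_sym (gT : finGroupType) (K S : {set gT}) :
  connection_set K S -> symmetric (cayley_adj S).
Proof.
by case=> _ SV _ x y; rewrite /cayley_adj -{1}SV mem_invg invMg invgK.
Qed.

Lemma cayley_adj_irr (gT : finGroupType) (K S : {set gT}) :
  connection_set K S -> irreflexive (cayley_adj S).
Proof. by case=> _ _ S1 x; rewrite /cayley_adj mulgV; apply: negbTE. Qed.

(* Main.v *)
(* H is a perfect code of G iff the nontrivial right cosets of H have an
   inverse-closed transversal S.  Since every right coset in HxH meets every
   left coset in HxH, a partial inverse-closed transversal can be enlarged by a
   pair {t, t^-1} unless it misses exactly one coset in a self-inverse double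
   coset, in which case an involution of HxH is needed.  By parity this yields
   the criterion: for all x in G with x^2 in H and |H : H :&: H^x| odd, the coset
   Hx contains an element of square 1.

   For such x, put L = H :&: H^x and M = L<x>.  Then L contains a Sylow
   2-subgroup Q of H (up to conjugacy), M / L is a 2-group, so M = LR for any
   Sylow 2-subgroup R of M, and R :&: L = Q when R contains Q.  Thus the coset Lx
   meets R, which normalises Q, and any involution in Lx is L-conjugate into R;
   this moves the criterion between H in G and Q in P. *)
Require Import Defs.
From mathcomp Require Import all_boot all_order all_fingroup all_solvable.

Set Implicit Arguments.
Unset Strict Implicit.
Unset Printing Implicit Defensive.

Local Open Scope group_scope.

(** * Perfect codes as inverse-closed transversals *)

Lemma perfect_code_transversalP (gT : finGroupType) (K H : {group gT}) :
    H \subset K ->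
  perfect_code_of K H <->
  exists S : {set gT},
    [/\ S \subset K :\: H, S^-1 = S,
        {in S &, forall s t, s * t^-1 \in H -> s = t} &
        K :\: H \subset H * S].
Proof.
move=> sHK; split=> [[S [sSK SV S1] [_ indep dom]] | [S [sSKH SV inj hit]]].
  have sSKH : S \subset K :\: H.
    apply/subsetP=> s sS; rewrite inE (subsetP sSK) // andbT.
    apply/negP=> sH; have := indep 1 s (group1 H) sH.
    by rewrite /cayley_adj invg1 mulg1 sS.
  (* The neighbours in [H] of the vertex [x^-1] are the [y] with [y * x] in [S], so unique
     domination of [x^-1] says that [S] meets [H :* x] exactly once. *)
  have domV x : x \in K :\: H -> #|[set y in H | y * x \in S]| = 1%N.
    rewrite inE => /andP[xH xK].
    by rewrite -(dom x^-1) ?inE ?groupV ?xH // /cayley_adj invgK.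
  exists S; split=> // [s t sS tS stH |].
    have /eqP/cards1P[y defy] := domV t (subsetP sSKH t tS).
    have: 1 \in [set y in H | y * t \in S] by rewrite inE group1 mul1g.
    have: s * t^-1 \in [set y in H | y * t \in S] by rewrite inE stH mulgKV.
    rewrite defy !inE => /eqP<- /eqP/(congr1 ( *%g^~ t)).
    by rewrite mul1g mulgKV.
  apply/subsetP=> x xKH; have /eqP/cards1P[y defy] := domV x xKH.
  have: y \in [set y in H | y * x \in S] by rewrite defy set11.
  by rewrite inE => /andP[yH yxS]; rewrite -[x](mulKg y) mem_mulg ?groupV.
have SH s : s \in S -> s \notin H.
  by move/(subsetP sSKH); rewrite inE => /andP[].
exists S; first split=> //.
- by apply: subset_trans sSKH (subsetDl _ _).
- by apply/negP=> /SH; rewrite group1.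
split=> // [x y xH yH | x].
  by apply/negP=> /SH; rewrite groupM ?groupV.
rewrite inE => /andP[xH xK].
have /(subsetP hit)/mulsgP[h s hH sS xV] : x^-1 \in K :\: H.
  by rewrite inE !groupV xH.
have sxH : s * x \in H.
  by rewrite -[s](mulKg h) -xV -mulgA mulVg mulg1 groupV.
apply/eqP/cards1P; exists (s * x); apply/setP=> y.
rewrite !inE /cayley_adj; apply/andP/eqP=> [[yH yxS] | ->]; last first.
  by rewrite sxH mulgK.
rewrite -(inj _ _ yxS sS) ?mulgKV //.
by rewrite -mulgA -invMg groupM ?groupV.
Qed.

(** * Counting cosets and fixed points of inversion *)

Lemma card_mul_transversal (gT : finGroupType) (H : {group gT})
    (A : {set gT}) :
    {in A &, forall s t, s * t^-1 \in H -> s = t} ->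
  #|H * A| = (#|H| * #|A|)%N.
Proof.
move=> inj; rewrite -cardsX -(@card_in_imset _ _ (fun p => p.1 * p.2)).
  apply: eq_card => y; apply/mulsgP/imsetP=> [[h a hH aA ->] | [[h a]]].
    by exists (h, a); rewrite ?inE ?hH.
  by rewrite inE /= => /andP[hH aA] ->; exists h a.
move=> [h a] [k b]; rewrite !inE /= => /andP[hH aA] /andP[kH bA] e.
have eab : a = b.
  apply: inj => //.
  have -> : a * b^-1 = h^-1 * k by rewrite -[a](mulKg h) e -!mulgA mulgV mulg1.
  by rewrite groupM ?groupV.
by move: e; rewrite eab => /mulIg->.
Qed.

(** Elements that differ from their inverse pair off, so an odd set keeps one that equals its
    inverse. *)
Lemma odd_invg_fixed (gT : finGroupType) (A : {set gT}) :
  A^-1 = A -> odd #|A| -> exists2 t, t \in A & t ^+ 2 = 1.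
Proof.
have [n] := ubnP #|A|; elim: n A => // n IHn A ltAn AV oddA.
have /card_gt0P[x xA] : 0 < #|A| by case: #|A| oddA.
have [x2 | x2] := eqVneq (x ^+ 2) 1; first by exists x.
have xVA : x^-1 \in A by rewrite -mem_invg AV.
have xVx : x^-1 != x.
  by apply: contraNneq x2 => e; rewrite expgS expg1 -{1}e mulVg.
have cA : #|A| = #|(A :\ x) :\ x^-1|.+2.
  by rewrite (cardsD1 x) xA (cardsD1 x^-1) !inE xVx xVA.
have [|||t] := IHn ((A :\ x) :\ x^-1).
- by move: ltAn; rewrite cA ltnS; apply: leq_trans.
- apply/setP=> y; rewrite mem_invg !inE -mem_invg AV.
  by rewrite eqg_inv eqg_invLR andbCA.
- by move: oddA; rewrite cA /= negbK.
by rewrite !inE => /and3P[_ _ tA] t2; exists t.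
Qed.

(** * Double cosets *)

Lemma dcosetP (gT : finGroupType) (H : {group gT}) (x y : gT) :
  reflect (exists h k, [/\ h \in H, k \in H & y = h * x * k])
          (y \in H :* x * H).
Proof.
apply: (iffP mulsgP) => [[_ k /rcosetP[h hH ->] kH ->] | [h [k [hH kH ->]]]].
  by exists h, k.
by exists (h * x) k; rewrite // mem_rcoset mulgK.
Qed.

Lemma dcoset_refl (gT : finGroupType) (H : {group gT}) (x : gT) :
  x \in H :* x * H.
Proof. by apply/dcosetP; exists 1, 1; rewrite group1 mul1g mulg1. Qed.

Lemma dcosetM (gT : finGroupType) (H : {group gT}) (x y h k : gT) :
  h \in H -> k \in H -> (h * y * k \in H :* x * H) = (y \in H :* x * H).
Proof.
move=> hH kH; apply/dcosetP/dcosetP=> -[a [b [aH bH e]]].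
  exists (h^-1 * a), (b * k^-1); rewrite !groupM ?groupV //; split=> //.
  by rewrite -[y](mulKg h) -[h * y](mulgK k) e !mulgA.
by exists (h * a), (b * k); rewrite !groupM // e !mulgA.
Qed.

(** The double coset is a left translate of [H :^ x * H], which the product formula measures; so the
    index is the number of right cosets of [H] in it. *)
Lemma card_dcoset (gT : finGroupType) (H : {group gT}) (x : gT) :
  #|H :* x * H| = (#|H| * #|H : H :&: H :^ x|)%N.
Proof.
apply/eqP; rewrite -(eqn_pmul2r (cardG_gt0 (H :&: H :^ x))) -mulnA.
rewrite [(#|_ : _| * _)%N]mulnC Lagrange ?subsetIl //.
have -> : H :* x * H = x *: (H :^ x * H).
  by rewrite conjsgE !mulgA mulg_set1 mulgV mul1g.
by rewrite card_lcoset /= setIC -mul_cardG cardJg.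
Qed.

Lemma mem_mulG (gT : finGroupType) (H : {group gT}) (A : {set gT})
    (x : gT) :
  (x \in H * A) = [exists a in A, x * a^-1 \in H].
Proof.
apply/mulsgP/exists_inP=> [[h a hH aA ->] | [a aA xaH]].
  by exists a; rewrite ?mulgK.
by exists (x * a^-1) a; rewrite ?mulgKV.
Qed.

Lemma dcoset_eq (gT : finGroupType) (H : {group gT}) (x y : gT) :
  y \in H :* x * H -> H :* y * H = H :* x * H.
Proof.
case/dcosetP=> h [k [hH kH ->]].
by rewrite !rcosetM (rcoset_id hH) -mulgA (lcoset_id kH).
Qed.

Lemma dcosetV (gT : finGroupType) (H : {group gT}) (x : gT) :
  (H :* x * H)^-1 = H :* x^-1 * H.
Proof. by rewrite !invMg !invGid invg_set1 mulgA. Qed.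

Lemma dcosetV_id (gT : finGroupType) (H : {group gT}) (x : gT) :
  x ^+ 2 \in H -> (H :* x * H)^-1 = H :* x * H.
Proof.
move=> x2H; rewrite dcosetV; apply: dcoset_eq; apply/dcosetP.
by exists 1, (x ^- 2); rewrite group1 groupV mul1g expg2 invMg mulKVg.
Qed.

Lemma dcoset_involution (gT : finGroupType) (H : {group gT}) (x t : gT) :
    t \in H :* x * H -> t ^+ 2 = 1 ->
  exists2 h, h \in H & (h * x) ^+ 2 = 1.
Proof.
case/dcosetP=> h [k [hH kH ->]] t2; exists (k * h); rewrite ?groupM //.
have -> : k * h * x = (h * x * k) ^ k^-1 by rewrite conjgE invgK !mulgA mulgK.
by rewrite -conjXg t2 conj1g.
Qed.

Lemma mem_mulG_setI_dcoset (gT : finGroupType) (H : {group gT}) (A : {set gT})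
    (x y : gT) :
  y \in H * (A :&: (H :* x * H)) = (y \in H * A) && (y \in H :* x * H).
Proof.
rewrite !mem_mulG; apply/exists_inP/andP=> [[a] | [/exists_inP[a aA yaH]]].
  rewrite inE => /andP[aA aD] yaH; split; first by apply/exists_inP; exists a.
  by rewrite -[y](mulgKV a) -[_ * a]mulg1 dcosetM.
move=> yD; exists a => //; rewrite inE aA /=.
have -> : a = (y * a^-1)^-1 * y * 1 by rewrite mulg1 invMg invgK mulgKV.
by rewrite dcosetM ?groupV.
Qed.

(** * The criterion by elements of square 1 *)

Lemma perfect_code_criterion (gT : finGroupType) (K H : {group gT}) :
    H \subset K ->
  perfect_code_of K H <->
  {in K, forall x, x ^+ 2 \in H -> odd #|H : H :&: H :^ x| ->
     exists2 h, h \in H & (h * x) ^+ 2 = 1}.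
Proof.
move=> sHK; apply: iff_trans (perfect_code_transversalP sHK) _.
split=> [[S [sSKH SV inj hit]] x xK x2H oddm | crit].
  have [xH | xH] := boolP (x \in H).
    by exists x^-1; rewrite ?groupV // mulVg expg1n.
  have DV := dcosetV_id x2H.
  have [t] : exists2 t, t \in S :&: (H :* x * H) & t ^+ 2 = 1.
    apply: odd_invg_fixed; first by rewrite invIg SV DV.
    (* [S] picks one element from each right coset in the double coset, hence an odd number in
       all. *)
    suff <- : #|H : H :&: H :^ x| = #|S :&: (H :* x * H)| by [].
    apply/eqP; rewrite -(eqn_pmul2l (cardG_gt0 H)) -card_dcoset.
    rewrite -card_mul_transversal.
      apply/eqP/eq_card=> y; rewrite mem_mulG_setI_dcoset andbC.
      case yD: (y \in _) => //=; symmetry.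
      apply: (subsetP hit); case/dcosetP: yD => h [k [hH kH ->]]; rewrite inE.
      by rewrite groupMr // groupMl // xH !groupM // (subsetP sHK).
    by move=> s t /setIP[sS _] /setIP[tS _]; apply: inj.
  by rewrite inE => /andP[_ tD]; apply: dcoset_involution tD.
(* [ptr] singles out the inverse-closed partial transversals; a maximal one will turn out to meet
   every coset. *)
pose ptr (S : {set gT}) := [&& S \subset K :\: H, S^-1 == S &
  [forall s in S, forall t in S, (s * t^-1 \in H) ==> (s == t)]].
have ptr0 : ptr set0.
  rewrite /ptr sub0set /=; apply/andP; split.
    by apply/eqP/setP=> y; rewrite mem_invg !inE.
  by apply/forall_inP=> s; rewrite inE.
have [S /maxsetP[/and3P[sSKH /eqP SV /forall_inP injb] maxS] _] :=
  maxset_exists ptr0.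
have inj : {in S &, forall s t, s * t^-1 \in H -> s = t}.
  move=> s t sS tS; move/forall_inP: (injb s sS).
  by move=> /(_ t tS) /implyP/[apply]/eqP.
exists S; split=> //; apply/subsetP=> x; rewrite inE => /andP[xH xK].
apply: contraT => xHS.
(* Maximality of [S] forbids adjoining [t] and [t^-1]. These share a coset exactly when [t ^+ 2] is
   in [H], and the last hypothesis then makes them equal. *)
have addS t : t \in K :\: H -> t \notin H * S -> t^-1 \notin H * S ->
    (t ^+ 2 \in H -> t ^+ 2 = 1) -> False.
  move=> tKH tHS tVHS t2.
  have tVKH : t^-1 \in K :\: H by rewrite !inE !groupV -in_setD.
  suff ptrT : ptr (S :|: [set t; t^-1]).
    have := maxS _ ptrT (subsetUl _ _).
    move/setP/(_ t); rewrite !inE eqxx orbT => /esym tS.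
    by case/negP: tHS; rewrite -[t]mul1g mem_mulg.
  apply/and3P; split.
  - rewrite subUset sSKH; apply/subsetP=> y.
    by rewrite !inE => /orP[]/eqP->; rewrite -in_setD.
  - apply/eqP/setP=> y; rewrite mem_invg !inE -mem_invg SV.
    by rewrite eqg_inv eqg_invLR [X in _ || X]orbC.
  have nH u s : u \notin H * S -> s \in S -> u * s^-1 \notin H.
    move=> uHS sS; apply: contra uHS => usH.
    by rewrite mem_mulG; apply/exists_inP; exists s.
  have nHV u s : u \notin H * S -> s \in S -> s * u^-1 \notin H.
    by move=> uHS sS; rewrite -groupV invMg invgK nH.
  apply/forall_inP=> a aT; apply/forall_inP=> b bT; apply/implyP=> abH.
  have tV u : u \in [set t; t^-1] -> u ^+ 2 \in H -> u^-1 = u.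
    move=> utV; suff uV : u ^+ 2 \in H -> u ^+ 2 = 1.
      by move/uV=> u2; apply/eqP; rewrite eq_invg_mul -expg2 u2.
    by case/set2P: utV => -> //; rewrite expVgn groupV => /t2->; rewrite invg1.
  move: aT bT; rewrite ![_ \in S :|: _]inE => /orP[aS | aT] /orP[bS | bT].
  - by rewrite (inj _ _ aS bS abH).
  - by case/set2P: bT abH => ->; rewrite (negPf (nHV _ _ _ aS)).
  - by case/set2P: aT abH => ->; rewrite (negPf (nH _ _ _ bS)).
  apply: contraT => ba.
  have eb : b = a^-1.
    by case/set2P: aT bT ba => -> /set2P[] ->; rewrite ?eqxx ?invgK.
  by case/eqP: ba; rewrite eb tV //; move: abH; rewrite eb invgK.
have HS_stable (h y : gT) : h \in H -> (h * y \in H * S) = (y \in H * S).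
  move=> hH; rewrite !mem_mulG; apply: eq_existsb => a.
  by rewrite -mulgA (groupMl _ hH).
have KHM h : h \in H -> h * x \in K :\: H.
  by move=> hH; rewrite inE groupMl // xH groupM // (subsetP sHK).
(* An element of square 1 in the missed coset is its own inverse, so it could be adjoined to [S]
   alone. *)
suff [h hH hx2] : exists2 h, h \in H & (h * x) ^+ 2 = 1.
  case: (addS (h * x)); rewrite ?KHM ?HS_stable //.
  have -> : (h * x)^-1 = h * x by apply/eqP; rewrite eq_invg_mul -expg2 hx2.
  by rewrite HS_stable.
set D := H :* x * H.
(* A second missed coset Hy in D^-1 meets (Hx)^-1, which gives a pair to add. *)
have [|sub] := boolP [exists y in D^-1 :\: H * S, y \notin H :* x].
  case/exists_inP=> y; rewrite inE mem_invg.
  case/andP=> yHS /dcosetP[h [k [hH kH e]]].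
  have ey : (h * x)^-1 = k * y.
    by rewrite -[y]invgK e !invMg mulKVg.
  rewrite mem_rcoset => yx; case: (addS (h * x)); rewrite ?KHM ?ey ?HS_stable //.
  move=> hx2H; case/negP: yx.
  have -> : y * x^-1 = k^-1 * (h * x) ^- 2 * h.
    rewrite -[y](mulKg k) -ey -{2}[x](mulKg h) [(h^-1 * _)^-1]invMg invgK.
    by rewrite expg2 [in RHS]invMg !mulgA.
  by rewrite !groupM ?groupV.
have sDHx : D^-1 :\: H * S \subset H :* x.
  apply/subsetP=> y yD; apply: contraR sub => yx.
  by apply/exists_inP; exists y.
have sHxD : H :* x \subset D :\: H * S.
  apply/subsetP=> y /rcosetP[h hH ->]; rewrite inE HS_stable // xHS /=.
  by rewrite -[_ * _]mulg1 dcosetM ?dcoset_refl.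
have cD y : #|H :* y * H| =
    (#|H| * #|S :&: (H :* y * H)%g| + #|(H :* y * H) :\: (H * S)%g|%g)%N.
  rewrite -card_mul_transversal; last first.
    by move=> s t /setIP[sS _] /setIP[tS _]; apply: inj.
  rewrite -(cardsID (H * S) (H :* y * H)); congr (_ + _)%N.
  by apply: eq_card => z; rewrite mem_mulG_setI_dcoset inE andbC.
(* [S] has equally many elements in [D] and [D^-1], so it misses equally much of both; with the two
   inclusions through [H :* x], all three sets agree. *)
have cDV : #|D^-1 :\: H * S| = #|D :\: H * S|.
  apply/eqP; rewrite -(eqn_add2l (#|H| * #|S :&: D|)) -cD; apply/eqP.
  have -> : #|S :&: D| = #|S :&: D^-1| by rewrite -{2}SV -invIg card_invg.
  by rewrite [D^-1]dcosetV -cD -dcosetV card_invg.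
have [eDHx eDV] : H :* x = D :\: H * S /\ H :* x = D^-1 :\: H * S.
  have: D^-1 :\: H * S == D :\: H * S.
    by rewrite eqEcard (subset_trans sDHx) // cDV /=.
  move/eqP=> e; split; apply/eqP; rewrite eqEsubset.
    by rewrite sHxD -e.
  by rewrite sDHx e sHxD.
(* Hx is now the only missed coset of D, and D is closed under inversion. *)
have xVD : x^-1 \in D.
  by have := rcoset_refl H x; rewrite eDV 2!inE => /andP[_].
have DV : D^-1 = D by rewrite dcosetV; apply: dcoset_eq.
have [oddA | evenA] := boolP (odd #|S :&: D|).
  have [|t /setIP[_ tD] t2] := odd_invg_fixed _ oddA.
    by rewrite invIg SV DV.
  exact: dcoset_involution tD t2.
(* The right cosets in [D] are the evenly many met by [S] and the missed one. *)
have oddm : odd #|H : H :&: H :^ x|.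
  suff -> : #|H : H :&: H :^ x| = #|S :&: D|.+1 by rewrite /= evenA.
  apply/eqP; rewrite -(eqn_pmul2l (cardG_gt0 H)) -card_dcoset cD -eDHx.
  by rewrite card_rcoset mulnS addnC.
(* [x ^+ 2] need not be in [H], but [x^-1 = h * x * k] gives [(k * x) ^+ 2 = k * h^-1], so the
   criterion is applied to [k * x]. *)
case/dcosetP: xVD => h [k [hH kH xVe]].
have [|||h' h'H h'2] := crit (k * x).
- by rewrite groupM // (subsetP sHK).
- have -> : (k * x) ^+ 2 = k * h^-1 * (h * x * k * x).
    by rewrite expg2 !mulgA mulgKV.
  by rewrite -xVe mulVg mulg1 groupM ?groupV.
- by rewrite conjsgM (conjGid kH).
by exists (h' * k); rewrite ?groupM // -mulgA.
Qed.

(** * Passage to Sylow 2-subgroups *)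

Lemma mul_normal_Sylow (gT : finGroupType) (p : nat) (L M R : {group gT}) :
  L <| M -> p.-group (M / L) -> p.-Sylow(M) R -> L * R = M.
Proof.
move=> nLM pML sylR; have [sLM nLM'] := andP nLM.
have sRM := pHall_sub sylR.
have eRM : R / L = M / L.
  by apply: pHall_id pML; apply: quotient_pHall sylR; apply: subset_trans nLM'.
rewrite -(quotientGK nLM) -eRM quotientK //.
exact: subset_trans nLM'.
Qed.

Lemma sqrg_mem_capJ (gT : finGroupType) (H : {group gT}) (x : gT) :
  x ^+ 2 \in H -> x ^+ 2 \in H :&: H :^ x.
Proof.
move=> x2H; rewrite inE x2H mem_conjg conjgE invgK.
by rewrite expg2 !mulgA mulgK -expg2.
Qed.

(** Since [x ^+ 2] normalises [H], conjugation by [x] swaps [H] and [H :^ x], so [x] normalises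
    their intersection. That contains [x ^+ 2], so adjoining [x] gives a quotient of order at most
    2. *)
Lemma capJ_normal_2index (gT : finGroupType) (H : {group gT}) (x : gT) :
    x ^+ 2 \in H ->
  exists2 M : {group gT}, x \in M &
    H :&: H :^ x <| M /\ 2.-group (M / (H :&: H :^ x)).
Proof.
move=> x2H; set L := (H :&: H :^ x)%G.
have nLx : x \in 'N(L).
  have Hxx : (H :^ x) :^ x = H by rewrite -conjsgM -expg2 conjGid.
  by apply/normP; rewrite /= conjIg Hxx setIC.
have x2L : x ^+ 2 \in L := sqrg_mem_capJ x2H.
have nLX : <[x]> \subset 'N(L) by rewrite cycle_subG.
exists (L <*> <[x]>)%G; first by rewrite mem_gen // inE cycle_id orbT.
split; first by rewrite /normal joing_subl join_subG normG.
rewrite quotientYidl // quotient_cycle //.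
rewrite /pgroup (pnat_dvd (n := 2)) // order_dvdn -morphX //.
by rewrite /= coset_id.
Qed.

Theorem theorem1p2 (gT : finGroupType) (G H Q P : {group gT})
    (sHG : H \subset G) (sylQ : 2.-Sylow(H) Q) (sylP : 2.-Sylow('N_G(Q)) P) :
  perfect_code_of G H <-> perfect_code_of P Q.
Proof.
have [sQH pQ oddHQ] := and3P sylQ.
have sQG := subset_trans sQH sHG.
have [sPN pP _] := and3P sylP.
have [sPG nQP] : P \subset G /\ P \subset 'N(Q).
  by apply/andP; rewrite -subsetI.
have sQP : Q \subset P.
  apply: normal_sub_max_pgroup (Hall_max sylP) pQ _.
  by rewrite /normal subsetI sQG normG subsetIr.
apply: iff_trans (perfect_code_criterion sHG) _.
apply: iff_trans (iff_sym (perfect_code_criterion sQP)).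
split=> [critH x xP x2Q _ | critQ x xG x2H oddm].
  have x2H := subsetP sQH _ x2Q.
  have [M xM []] := capJ_normal_2index x2H.
  set L := (H :&: H :^ x)%G => nLM pML; have [sLM nLM'] := andP nLM.
  have Qx : Q :^ x = Q by apply: normP; apply: (subsetP nQP).
  have sQL : Q \subset L by rewrite subsetI sQH -Qx conjSg.
  have sylQL := pHall_subl sQL (subsetIl H _) sylQ.
  have [h hH hx2] : exists2 h, h \in H & (h * x) ^+ 2 = 1.
    apply: critH => //; first exact: (subsetP sPG).
    by rewrite odd_2'nat; apply: pnat_dvd oddHQ; apply: indexgS.
  (* Expanding [(h * x) ^+ 2 = 1] writes the conjugate of [h] by [x^-1] as [h^-1 * x ^- 2], an
     element of [H]. *)
  have hL : h \in L.
    rewrite inE hH mem_conjg.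
    have -> : h ^ x^-1 = h^-1 * (h * x) ^+ 2 * x ^- 2.
      by rewrite conjgE invgK !expg2 invMg -!mulgA mulKg !mulgA mulgK.
    by rewrite hx2 mulg1 groupM ?groupV.
  have tM : h * x \in M by rewrite groupM // (subsetP sLM).
  have p_t : 2.-group <[h * x]>.
    by rewrite /pgroup (pnat_dvd (n := 2)) // order_dvdn hx2.
  have sQxM : Q <*> <[x]> \subset M.
    by rewrite join_subG cycle_subG xM (subset_trans sQL).
  have p_Qx : 2.-group (Q <*> <[x]>).
    by apply: pgroupS pP; rewrite join_subG sQP cycle_subG.
  have [R sylR] := Sylow_superset sQxM p_Qx.
  rewrite join_subG cycle_subG => /andP[sQR xR].
  have eRL : R :&: L = Q.
    apply: sub_pHall sylQL _ _ (subsetIr _ _).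
      by apply: pgroupS (subsetIl _ _) (pHall_pgroup sylR).
    by rewrite subsetI sQR.
  have [|m mM] := Sylow_Jsub sylR _ p_t; first by rewrite cycle_subG.
  rewrite -cycleJ cycle_subG => tmR.
  (* As [M = L * R], conjugating by the factor [l] alone already brings [h * x] into [R], and this
     stays within the coset [L :* x]. *)
  move: mM; rewrite -(mul_normal_Sylow nLM pML sylR) => /mulsgP[l r lL rR em].
  have tlR : (h * x) ^ l \in R.
    by move: tmR; rewrite em conjgM memJ_norm // (subsetP (normG R)).
  exists ((h * x) ^ l * x^-1); last first.
    by rewrite mulgKV -conjXg hx2 conj1g.
  have lxL : l ^ x^-1 \in L by rewrite memJ_norm // groupV (subsetP nLM').
  rewrite -eRL in_setI (groupM tlR) ?groupV //.
  have -> : (h * x) ^ l * x^-1 = l^-1 * h * l ^ x^-1.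
    by rewrite !conjgE invgK !mulgA.
  by apply: groupM lxL; apply: groupM hL; rewrite groupV.
have [M xM []] := capJ_normal_2index x2H.
set L := (H :&: H :^ x)%G => nLM pML; have [sLM nLM'] := andP nLM.
have [Q1 sylQ1] := Sylow_exists 2 L.
have [sQ1L pQ1 oddLQ1] := and3P sylQ1.
(* The index of [L] in [H] is odd, so a Sylow 2-subgroup of [L] is one of [H]. *)
have [|a aH eQ1] := Sylow_trans sylQ (Q := Q1).
  rewrite /pHall (subset_trans sQ1L (subsetIl _ _)) pQ1.
  rewrite -(Lagrange_index (subsetIl H (H :^ x)) sQ1L) pnatM oddLQ1.
  by rewrite -odd_2'nat oddm.
have [R sylR sQ1R] := Sylow_superset (subset_trans sQ1L sLM) pQ1.
have eRL : R :&: L = Q1.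
  apply: sub_pHall sylQ1 _ _ (subsetIr _ _).
    by apply: pgroupS (subsetIl _ _) (pHall_pgroup sylR).
  by rewrite subsetI sQ1R.
(* [x] is replaced by [r], in the same coset of [L] but inside [R]; it normalises [R :&: L = Q1],
   which contains its square. *)
move: (xM); rewrite -(mul_normal_Sylow nLM pML sylR) => /mulsgP[l r lL rR ex].
have er : r = l^-1 * x by rewrite ex mulKg.
have lH : l \in H by case/setIP: lL.
have r2Q1 : r ^+ 2 \in Q1.
  rewrite -eRL in_setI groupX //.
  have -> : r ^+ 2 = l^-1 * l^-1 ^ x^-1 * x ^+ 2.
    by rewrite er conjgE invgK !expg2 !mulgA mulgKV.
  have x2L : x ^+ 2 \in L := sqrg_mem_capJ x2H.
  have lxL : l^-1 ^ x^-1 \in L by rewrite memJ_norm groupV // (subsetP nLM').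
  by apply: groupM x2L; apply: groupM lxL; rewrite groupV.
have nQ1r : r \in 'N(Q1).
  have: R \subset 'N(R :&: L).
    by rewrite normsI ?normG // (subset_trans (pHall_sub sylR)).
  by rewrite eRL => /subsetP->.
have aG := subsetP sHG _ aH.
(* Conjugation by [a^-1] turns [Q1] into [Q]; a second one, by an element of ['N_G(Q)], will bring
   [z] into [P]. *)
pose z := r ^ a^-1.
have eQ : Q1 :^ a^-1 = Q :> {set gT} by rewrite eQ1 conjsgK.
have zN : <[z]> \subset 'N_G(Q).
  have nQz : z \in 'N(Q1 :^ a^-1) by rewrite normJ memJ_conjg.
  rewrite cycle_subG in_setI -eQ nQz andbT /z er.
  by rewrite groupJ ?groupM ?groupV // (subsetP sHG).
have p_z : 2.-group <[z]>.
  by rewrite cycleJ pgroupJ (pgroupS _ (pHall_pgroup sylR)) ?cycle_subG.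
have [b /setIP[bG nQb]] := Sylow_subJ sylP zN p_z.
rewrite cycle_subG mem_conjg => yP.
have nQy := subsetP nQP _ yP.
have [||q qQ qy2] := critQ _ yP.
- by rewrite -conjXg memJ_norm ?groupV // -eQ -conjXg memJ_conjg.
- by rewrite (normP nQy) setIid indexgg.
(* Conjugating [q * z ^ b^-1], of square 1, back by [b * a] gives [q ^ (b * a) * r], where
   [r = l^-1 * x]. *)
exists (q ^ (b * a) * l^-1).
  by rewrite groupM ?groupV // conjgM groupJ // (subsetP sQH) ?memJ_norm.
have -> : q ^ (b * a) * l^-1 * x = (q * z ^ b^-1) ^ (b * a).
  by rewrite -mulgA -er conjMg !conjgM !conjgKV.
by rewrite -conjXg qy2 conj1g.
Qed.
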